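(* Let $(\mathcal C,U)$ be a topological concrete category. There is a functor $\mathrm{word}:\mathbf{Seq}_{<\infty}\to\mathbf{TSD}$, from the category of subshifts in $\mathcal C$ with finite morphisms to the category of time series data in $\mathcal C$, given on objects by $\mathrm{word}(S)_n:=\mathrm{word}_n(S)$ for $n\ge0$, where $\mathrm{word}(S)$ has the alphabet $\mathbb A$ of $S$ and its structure morphisms $s_n,f_n:\mathrm{word}_n(S)\to\mathrm{word}_{n-1}(S)$ are the restrictions of the maps $\mathbb A^{n+1}\to\mathbb A^n$ deleting the first, respectively last, coordinate.
   Context: Topological concrete category: a category $\mathcal C$ with a faithful functor $U:\mathcal C\to\mathbf{Set}$ such that for every set $X$, every family $(\Omega_i)_{i\in I}$ of objects and maps $f_i:X\to U\Omega_i$, there is an initial lift: an object $\bar\Omega$ with $U\bar\Omega=X$ and morphisms $g_i:\bar\Omega\to\Omega_i$ with $Ug_i=f_i$, such that whenever $\phi:U\Omega'\to X$ is a map and $g_i':\Omega'\to\Omega_i$ are morphisms with $Ug'_i=f_i\circ\phi$ for all $i$, there is a unique $\psi:\Omega'\to\bar\Omega$ with $U\psi=\phi$ and $g_i'=g_i\circ\psi$. (Final lifts exist dually.) Then $\mathcal C$ is complete and cocomplete, $U$ preserves limits, and monomorphisms (epimorphisms) are the morphisms with injective (surjective) underlying map. For $f:X\to Y$, $\operatorname{im}f$ is the object with underlying set the image of $Uf$ with the final structure for $UX\to\operatorname{im}(Uf)$; this gives $X\twoheadrightarrow\operatorname{im}f\hookrightarrow Y$. For an object $\mathbb A$ (alphabet)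 the shift $\sigma:\mathbb A^{\mathbb N_0}\to\mathbb A^{\mathbb N_0}$ is the unique morphism with $\pi_n\sigma=\pi_{n+1}$. A subshift on $\mathbb A$ is a subobject $m:S\hookrightarrow\mathbb A^{\mathbb N_0}$ such that the inclusion $\operatorname{im}(\sigma m)\hookrightarrow\mathbb A^{\mathbb N_0}$ factors through $m$; it carries $\sigma|_S:S\to S$ with $m\circ\sigma|_S=\sigma\circ m$. $\mathbf{Seq}$ has subshifts as objects and, as morphisms $S\to S'$, the $\mathcal C$-morphisms $f$ with $f\circ\sigma|_S=\sigma|_{S'}\circ f$. $\mathrm{word}_n(S)$ is the image of the composite $S\hookrightarrow\mathbb A^{\mathbb N_0}\to\mathbb A^{n+1}$ (projection to the first $n+1$ coordinates), with epimorphism $e_n:S\twoheadrightarrow\mathrm{word}_n(S)$. A morphism $f:S\to S'$ in $\mathbf{Seq}$ is an $n$-morphism if there is $f_0:\mathrm{word}_n(S)\to\mathrm{word}_0(S')$ with $f_0\circ e_n=e'_0\circ f$; it is finite if it is an $n$-morphism for some $n\ge0$. $\mathbf{Seq}_{<\infty}$ has the subshifts as objects and the finite morphisms as morphisms. $\mathbf{TSD}$: an object is an alphabet $\mathbb A\in\mathcal C$ and subobjects $X_n\hookrightarrow\mathbb A^{n+1}$, $n\ge0$, with morphisms $s_n,f_n:X_n\to X_{n-1}$ ($n\ge1$) restricting the maps $\mathbb A^{n+1}\to\mathbb A^n$ deleting the first, respectively last, coordinate. A morphism $X\to Y$ is an integer $k\ge0$ (its jump) and $\mathcal C$-morphisms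 $\psi_n:X_{n+k}\to Y_n$, $n\ge0$, with $\psi_ns_{n+1+k}=s_{n+1}\psi_{n+1}$ and $\psi_nf_{n+1+k}=f_{n+1}\psi_{n+1}$. The composite of $(k,\phi):X\to Y$ and $(l,\psi):Y\to Z$ is $(k+l,(\psi_n\circ\phi_{n+l})_n)$.
   Formalization: A morphism of Seq_{<∞} is here a finite morphism together with a chosen n for which it is an n-morphism (the n add under composition, identities have n=0); with bare finite morphisms no such functor exists, as a full shift and its 2-block presentation are isomorphic but have different word_0. *)

(* Defs.v *)
From mathcomp Require Import all_boot boolp.

Set Implicit Arguments.
Unset Strict Implicit.
Unset Printing Implicit Defensive.

#[local] Obligation Tactic := idtac.

Record category := Category {
  ob :> Type;
  hom : ob -> ob -> Type;
  idm : forall A, hom A A;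
  comp : forall A B C, hom B C -> hom A B -> hom A C;
  compA : forall A B C D (h : hom C D) (g : hom B C) (f : hom A B),
    comp h (comp g f) = comp (comp h g) f;
  comp1m : forall A B (f : hom A B), comp (idm B) f = f;
  compm1 : forall A B (f : hom A B), comp f (idm A) = f }.

Arguments hom {c} _ _.
Arguments idm {c} A.
Arguments comp {c A B C} _ _.

Notation "g \c f" := (comp g f) (at level 50, left associativity).

(* The action on morphisms is separated from the object map, so that one can
   speak of "a functor given on objects by F0" without transports. *)
Record functor_on (C D : category) (F0 : C -> D) := FunctorOn {
  fmap :> forall A B : C, hom A B -> hom (F0 A) (F0 B);
  fmap1 : forall A, fmap (idm A) = idm (F0 A);
  fmapM : forall A B E (g : hom B E) (f : hom A B),
    fmap (g \c f) = fmap g \c fmap f }.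

Arguments fmap {C D F0} _ {A B} _.

Record functor (C D : category) := Functor {
  fob :> C -> D;
  fact : functor_on fob }.

Definition fhom C D (F : functor C D) (A B : C) (f : hom A B) :
  hom (F A) (F B) := fmap (fact F) f.

Arguments fhom {C D} F {A B} f.

Definition faithful C D (F : functor C D) :=
  forall (A B : C) (f g : hom A B), fhom F f = fhom F g -> f = g.

Definition mono (C : category) (A B : C) (m : hom A B) :=
  forall (X : C) (f g : hom X A), m \c f = m \c g -> f = g.

Definition SetCat : category :=
  @Category Type (fun X Y => X -> Y) (fun _ x => x)
    (fun _ _ _ g f x => g (f x))
    (fun _ _ _ _ _ _ _ => erefl) (fun _ _ _ => erefl) (fun _ _ _ => erefl).

Definition under C (U : functor C SetCat) (A B : C) (f : hom A B) :
  U A -> U B := fhom U f.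
Arguments under {C} U {A B} f _.

(* The identity map along an equality of sets. *)
Definition recast (X Y : Type) (e : X = Y) : X -> Y :=
  fun x => ecast Z Z e x.

Lemma recastK X Y (e : X = Y) : cancel (recast e) (recast (esym e)).
Proof. by case: _ / e. Qed.

Lemma recastVK X Y (e : X = Y) : cancel (recast (esym e)) (recast e).
Proof. by case: _ / e. Qed.

Record initial_lift (C : category) (U : functor C SetCat) (X : Type)
    (I : Type) (Om : I -> C) (f : forall i, X -> U (Om i)) := InitialLift {
  il_ob : C;
  il_set : U il_ob = X;
  il_mor : forall i, hom il_ob (Om i);
  il_morE : forall i, under U (il_mor i) = f i \o recast il_set;
  il_univ : forall (Om' : C) (phi : U Om' -> X) (g' : forall i, hom Om' (Om i)),
    (forall i, under U (g' i) = f i \o phi) ->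
    exists! psi : hom Om' il_ob,
      recast il_set \o under U psi = phi /\ forall i, g' i = il_mor i \c psi }.

Record final_lift (C : category) (U : functor C SetCat) (X : Type)
    (I : Type) (Om : I -> C) (f : forall i, U (Om i) -> X) := FinalLift {
  fl_ob : C;
  fl_set : X = U fl_ob;
  fl_mor : forall i, hom (Om i) fl_ob;
  fl_morE : forall i, under U (fl_mor i) = recast fl_set \o f i;
  fl_univ : forall (Om' : C) (phi : X -> U Om') (g' : forall i, hom (Om i) Om'),
    (forall i, under U (g' i) = phi \o f i) ->
    exists! psi : hom fl_ob Om',
      under U psi \o recast fl_set = phi /\ forall i, g' i = psi \c fl_mor i }.

(* As usual for topological functors, the index I of a family need not be
   small: its universe is only required to contain that of the objects. *)
Record topcat := Topcat {
  tcat :> category;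
  forget : functor tcat SetCat;
  forget_faithful : faithful forget;
  initial_lifts : forall (X : Type) (I : Type) (Om : I -> tcat)
    (f : forall i, X -> forget (Om i)), inhabited (initial_lift f) }.

Lemma under_inj (T : topcat) (A B : T) (f g : hom A B) :
  under (forget T) f = under (forget T) g -> f = g.
Proof. exact: forget_faithful. Qed.

Lemma underM (T : topcat) (A B C : T) (g : hom B C) (f : hom A B) :
  under (forget T) (g \c f) = under (forget T) g \o under (forget T) f.
Proof. by rewrite /under /fhom fmapM. Qed.

Lemma final_lifts (T : topcat) (X I : Type) (Om : I -> T)
  (f : forall i, forget T (Om i) -> X) : inhabited (final_lift f).
Proof.
pose J := {B : T & {h : X -> forget T B |
  forall i, exists g : hom (Om i) B, under (forget T) g = h \o f i}}.
have [L] := @initial_lifts T X J (fun j => projT1 j)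
  (fun j => sval (projT2 j)).
have lift i : exists g : hom (Om i) (il_ob L),
    recast (il_set L) \o under (forget T) g = f i.
  have gP (j : J) : exists g : hom (Om i) (projT1 j),
    under (forget T) g = sval (projT2 j) \o f i by case: j => B [h hP]; exact: hP.
  have [g [[gE _] _]] := @il_univ _ _ _ _ _ _ L (Om i) (f i)
    (fun j => sval (cid (gP j))) (fun j => svalP (cid (gP j))).
  by exists g.
pose g i := sval (cid (lift i)).
have gE i : recast (il_set L) \o under (forget T) (g i) = f i
  := svalP (cid (lift i)).
constructor; exists (il_ob L) (esym (il_set L)) g.
  by move=> i; apply/funext => x; rewrite -(gE i) /= recastK.
move=> B phi g' g'E.
have phiP i : exists g : hom (Om i) B, under (forget T) g = phi \o f i.
  by exists (g' i).
pose j : J := existT _ B (exist _ phi phiP).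
exists (il_mor L j); split; first split.
- rewrite (il_morE L j) /=; apply/funext => x /=; by rewrite recastVK.
- move=> i; apply: under_inj.
  by rewrite g'E underM (il_morE L j) /= -(gE i).
- move=> psi [psiE _]; apply: under_inj.
  rewrite (il_morE L j) /= -psiE; apply/funext => x /=.
  by rewrite recastK.
Qed.

Section Topological.
Context {T : topcat}.
Implicit Types A B C : T.

Local Notation U := (forget T).

Lemma inj_mono A B (m : hom A B) : injective (under U m) -> mono m.
Proof.
move=> minj X f g e; apply: under_inj; apply/funext => x.
by apply: minj; move/(congr1 (under U)): e; rewrite !underM => /(congr1 (@^~ x)).
Qed.

(* The power A^I, with underlying set I -> U A and the initial structure for
   the evaluation maps; power_univ says that it is the categorical power. *)
Definition power_lift A (I : Type) :
    @initial_lift T U (I -> U A) I (fun=> A) (fun i x => x i) :=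
  sval (cid (let: inhabits L := initial_lifts _ in ex_intro xpredT L erefl)).

Definition power A (I : Type) : T := il_ob (power_lift A I).

Definition proj A (I : Type) (i : I) : hom (power A I) A :=
  il_mor (power_lift A I) i.

Lemma power_univ A I B (g : I -> hom B A) :
  exists! h : hom B (power A I), forall i, proj A i \c h = g i.
Proof.
have [|h [[h1 h2] hU]] := @il_univ _ _ _ _ _ _ (power_lift A I) B
  (fun b i => under U (g i) b) g; first by [].
exists h; split=> [i|h' h'E]; first by rewrite h2.
apply: hU; split=> [|i]; last by rewrite h'E.
apply/funext => b; apply/funext => i; rewrite -h'E underM /=.
by rewrite /proj (il_morE (power_lift A I)).
Qed.

Definition tupling A I B (g : I -> hom B A) : hom B (power A I) :=
  sval (cid (power_univ g)).

Lemma proj_tupling A I B (g : I -> hom B A) i : proj A i \c tupling g = g i.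
Proof. by rewrite /tupling; case: cid => h [hE _] /=. Qed.

Lemma power_ext A I B (h h' : hom B (power A I)) :
  (forall i, proj A i \c h = proj A i \c h') -> h = h'.
Proof.
move=> e; have [k [_ kU]] := power_univ (fun i => proj A i \c h').
by rewrite -(kU h) // -(kU h').
Qed.

Lemma power_pt_ext A I (x y : U (power A I)) :
  (forall i, under U (proj A i) x = under U (proj A i) y) -> x = y.
Proof.
move=> xy; rewrite -(recastK (il_set (power_lift A I)) x).
rewrite -(recastK (il_set (power_lift A I)) y); congr recast.
by apply/funext => i; have := xy i; rewrite /proj (il_morE (power_lift A I)).
Qed.

(* The morphism A^I -> A^J selecting the coordinates u j, for j : J. *)
Definition reindex A I J (u : J -> I) : hom (power A I) (power A J) :=
  tupling (fun j => proj A (u j)).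

Lemma proj_reindex A I J (u : J -> I) j :
  proj A j \c reindex A u = proj A (u j).
Proof. exact: proj_tupling. Qed.

Lemma reindex_comp A I J K (u : J -> I) (v : K -> J) :
  reindex A v \c reindex A u = reindex A (u \o v).
Proof. by apply: power_ext => k; rewrite compA !proj_reindex. Qed.

Definition shift A : hom (power A nat) (power A nat) := reindex A succn.

Definition first_coords A n : hom (power A nat) (power A 'I_n.+1) :=
  reindex A (@nat_of_ord n.+1).

(* lift ord0 is i |-> i + 1 and lift ord_max is i |-> i. *)
Definition del_first A n : hom (power A 'I_n.+2) (power A 'I_n.+1) :=
  reindex A (lift ord0).

Definition del_last A n : hom (power A 'I_n.+2) (power A 'I_n.+1) :=
  reindex A (lift ord_max).

Definition set_im (X Y : Type) (f : X -> Y) : Type := {y | exists x, f x = y}.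

Definition corestr X Y (f : X -> Y) (x : X) : set_im f :=
  exist _ (f x) (ex_intro _ x erefl).

Definition im_lift A B (f : hom A B) :
    @final_lift T U (set_im (under U f)) unit (fun=> A)
      (fun=> corestr (under U f)) :=
  sval (cid (let: inhabits L := final_lifts _ in ex_intro xpredT L erefl)).

Definition im A B (f : hom A B) : T := fl_ob (im_lift f).

Definition im_epi A B (f : hom A B) : hom A (im f) := fl_mor (im_lift f) tt.

Lemma im_inc_subproof A B (f : hom A B) :
  exists i : hom (im f) B, under U i \o recast (fl_set (im_lift f)) = sval.
Proof.
have [//|i [[iE _] _]] := @fl_univ _ _ _ _ _ _ (im_lift f) B sval (fun=> f).
by exists i.
Qed.

Definition im_inc A B (f : hom A B) : hom (im f) B :=
  sval (cid (im_inc_subproof f)).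

Lemma im_incE A B (f : hom A B) :
  under U (im_inc f) \o recast (fl_set (im_lift f)) = sval.
Proof. by rewrite /im_inc; case: cid. Qed.

Lemma im_fact A B (f : hom A B) : im_inc f \c im_epi f = f.
Proof.
apply: under_inj; rewrite underM /im_epi (fl_morE (im_lift f)).
by apply/funext => x; exact: (congr1 (@^~ _) (im_incE f)).
Qed.

Lemma sval_inj (X : Type) (P : X -> Prop) : injective (@sval X P).
Proof. by move=> [x px] [y py] /= e; case: _ / e py => py; congr exist. Qed.

Lemma im_inc_inj A B (f : hom A B) : injective (under U (im_inc f)).
Proof.
move=> x y; rewrite -(recastVK (fl_set (im_lift f)) x).
rewrite -(recastVK (fl_set (im_lift f)) y) => xy.
by congr recast; apply: sval_inj; rewrite -im_incE.
Qed.

Lemma im_inc_mono A B (f : hom A B) : mono (im_inc f).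
Proof. apply: inj_mono; exact: im_inc_inj. Qed.

Lemma im_factor A B C (f : hom A B) (h : hom A C) :
  (forall x y, under U (im_epi f) x = under U (im_epi f) y ->
     under U h x = under U h y) ->
  exists k : hom (im f) C, k \c im_epi f = h.
Proof.
move=> fh.
pose phi (y : set_im (under U f)) := under U h (sval (cid (svalP y))).
have [|k [[_ kE] _]] := @fl_univ _ _ _ _ _ _ (im_lift f) C phi (fun=> h).
  move=> _; apply/funext => x; rewrite /phi /=.
  case: cid => x' /= xx'; apply: fh; rewrite /im_epi (fl_morE (im_lift f)) /=.
  by congr recast; apply: sval_inj.
by exists k; rewrite (kE tt).
Qed.

Lemma im_epi_surj A B (f : hom A B) z : exists x, under U (im_epi f) x = z.
Proof.
have [x xE] := svalP (recast (esym (fl_set (im_lift f))) z).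
exists x; rewrite /im_epi (fl_morE (im_lift f)) /=.
rewrite -[RHS](recastVK (fl_set (im_lift f))); congr recast.
exact: sval_inj.
Qed.

Lemma im_epi_epi A B C (f : hom A B) (h k : hom (im f) C) :
  h \c im_epi f = k \c im_epi f -> h = k.
Proof.
move=> e; apply: under_inj; apply/funext => z.
have [x <-] := im_epi_surj z.
by move/(congr1 (under U)): e; rewrite !underM => /(congr1 (@^~ x)).
Qed.

End Topological.

Record subshift (T : topcat) := Subshift {
  alphabet : T;
  space :> T;
  incl : hom space (power alphabet nat);
  incl_mono : mono incl;
  incl_shift : exists h : hom (im (shift alphabet \c incl)) space,
    incl \c h = im_inc (shift alphabet \c incl) }.

Section Subshifts.
Context {T : topcat}.
Implicit Types S : subshift T.

Local Notation U := (forget T).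

Lemma shift_on_subproof S :
  exists s : hom S S, incl S \c s = shift (alphabet S) \c incl S.
Proof.
have [h hE] := incl_shift S; exists (h \c im_epi _).
by rewrite compA hE im_fact.
Qed.

Definition shift_on S : hom S S := sval (cid (shift_on_subproof S)).

Lemma shift_onE S : incl S \c shift_on S = shift (alphabet S) \c incl S.
Proof. by rewrite /shift_on; case: cid. Qed.

Record seq_hom S S' := SeqHom {
  seq_mor :> hom S S';
  seq_morE : seq_mor \c shift_on S = shift_on S' \c seq_mor }.

Lemma seq_hom_ext S S' (f g : seq_hom S S') :
  seq_mor f = seq_mor g -> f = g.
Proof.
case: f g => [f fE] [g gE] /= fg; case: _ / fg gE => gE.
by congr SeqHom; exact: Prop_irrelevance.
Qed.

Lemma seq_id_subproof S : idm S \c shift_on S = shift_on S \c idm S.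
Proof. by rewrite comp1m compm1. Qed.

Lemma seq_comp_subproof S S' S'' (g : seq_hom S' S'') (f : seq_hom S S') :
  (g \c f) \c shift_on S = shift_on S'' \c (g \c f).
Proof. by rewrite -compA seq_morE !compA seq_morE. Qed.

Definition seq_id S : seq_hom S S := SeqHom (seq_id_subproof S).

Definition seq_comp S S' S'' (g : seq_hom S' S'') (f : seq_hom S S') :
  seq_hom S S'' := SeqHom (seq_comp_subproof g f).

Definition word n S : T := im (first_coords (alphabet S) n \c incl S).

Definition word_epi n S : hom S (word n S) := im_epi _.

Definition word_inc n S : hom (word n S) (power (alphabet S) 'I_n.+1) :=
  im_inc _.

Definition nmorphism n S S' (f : seq_hom S S') :=
  exists f0 : hom (word n S) (word 0 S'),
    f0 \c word_epi n S = word_epi 0 S' \c f.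

Definition finite S S' (f : seq_hom S S') := exists n, nmorphism n f.

Definition coord S (x : U S) i : U (alphabet S) :=
  under U (proj (alphabet S) i) (under U (incl S) x).

Lemma word_epi_eq n S (x y : U S) :
  under U (word_epi n S) x = under U (word_epi n S) y <->
  forall i, i <= n -> coord x i = coord y i.
Proof.
have fcE (i : 'I_n.+1) z : coord z i = under U (proj (alphabet S) i)
    (under U (word_inc n S) (under U (word_epi n S) z)).
  have := im_fact (first_coords (alphabet S) n \c incl S).
  move=> /(congr1 (under U)) /(congr1 (@^~ z)).
  rewrite !underM /= => ->.
  have := proj_reindex (alphabet S) (@nat_of_ord n.+1) i.
  by move=> /(congr1 (under U)) /(congr1 (@^~ (under U (incl S) z))); rewrite underM.
split=> [xy i ile|xy].
  by rewrite (fcE (Ordinal (ile : i < n.+1))) xy -fcE.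
apply: (@im_inc_inj T); apply: power_pt_ext => i.
by rewrite -!fcE xy // -ltnS.
Qed.

Lemma coord_shift S (x : U S) i : coord (under U (shift_on S) x) i = coord x i.+1.
Proof.
rewrite /coord.
have /(congr1 (under U)) /(congr1 (@^~ x)) := shift_onE S.
rewrite !underM /= => ->.
have := proj_reindex (alphabet S) succn i.
by move=> /(congr1 (under U)) /(congr1 (@^~ (under U (incl S) x))); rewrite underM.
Qed.

Lemma nmorphism_coord n S S' (f : seq_hom S S') : nmorphism n f ->
  forall (j : nat) (x y : U S),
    (forall i, i <= j + n -> coord x i = coord y i) ->
  coord (under U f x) j = coord (under U f y) j.
Proof.
move=> [f0 f0E]; elim=> [|j IH] x y xy.
  suff /word_epi_eq -> : under U (word_epi 0 S') (under U f x) =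
    under U (word_epi 0 S') (under U f y) by [].
  have fE z : under U (word_epi 0 S') (under U f z) =
      under U f0 (under U (word_epi n S) z).
    by move/(congr1 (under U)): f0E => /(congr1 (@^~ z)); rewrite !underM.
  by rewrite !fE; congr under; apply/word_epi_eq.
have fS z : under U (shift_on S') (under U f z) =
    under U f (under U (shift_on S) z).
  by move/(congr1 (under U)): (seq_morE f) => /(congr1 (@^~ z)); rewrite !underM.
rewrite -!coord_shift !fS; apply: IH => i ij.
by rewrite !coord_shift xy.
Qed.

Lemma nmorphism_word n S S' (f : seq_hom S S') : nmorphism n f ->
  forall m, exists psi : hom (word (m + n) S) (word m S'),
    psi \c word_epi (m + n) S = word_epi m S' \c f.
Proof.
move=> fn m; apply: im_factor => x y /word_epi_eq xy.
rewrite !underM /=.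
apply: (@word_epi_eq m S' (under U f x) (under U f y)).2 => j jm.
apply: (nmorphism_coord fn) => i ij; apply: xy.
by rewrite (leq_trans ij) // leq_add2r.
Qed.

Lemma nmorphism_id S : nmorphism 0 (seq_id S).
Proof. by exists (idm _); rewrite comp1m compm1. Qed.

Lemma nmorphism_comp n m S S' S'' (f : seq_hom S S') (g : seq_hom S' S'') :
  nmorphism n f -> nmorphism m g -> nmorphism (n + m) (seq_comp g f).
Proof.
move=> fn [g0 g0E]; have [psi psiE] := nmorphism_word fn m.
rewrite addnC; exists (g0 \c psi).
by rewrite -compA psiE compA g0E -compA.
Qed.

(* The morphisms of the category of finite morphisms carry an n for which they
   are n-morphisms; n becomes the jump of the induced morphism of time series
   data.  With the bare condition [finite] there would be no functor to TSD:
   there jumps add up, so isomorphisms have jump 0 and preserve words of length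
   1 up to isomorphism, but the full shift on two letters and its 2-block
   presentation (four letters) are isomorphic through finite morphisms. *)
Record fin_hom S S' := FinHom {
  fin_mor :> seq_hom S S';
  window : nat;
  fin_morP : nmorphism window fin_mor }.

Lemma finiteP S S' (f : seq_hom S S') :
  finite f <-> exists g : fin_hom S S', fin_mor g = f.
Proof.
split=> [[n fn]|[g <-]]; last by exists (window g); exact: fin_morP.
by exists (FinHom fn).
Qed.

Lemma fin_hom_ext S S' (f g : fin_hom S S') :
  seq_mor f = seq_mor g -> window f = window g -> f = g.
Proof.
case: f g => [f n fn] [g m gm] /= /seq_hom_ext fg nm.
case: _ / fg gm; case: _ / nm => gm.
by congr FinHom; exact: Prop_irrelevance.
Qed.

Definition fin_id S : fin_hom S S := FinHom (nmorphism_id S).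

Definition fin_comp S S' S'' (g : fin_hom S' S'') (f : fin_hom S S') :
  fin_hom S S'' := FinHom (nmorphism_comp (fin_morP f) (fin_morP g)).

End Subshifts.

Program Definition Seq (T : topcat) : category :=
  @Category (subshift T) seq_hom seq_id seq_comp _ _ _.
Next Obligation. by move=> *; apply: seq_hom_ext; rewrite /= compA. Qed.
Next Obligation. by move=> *; apply: seq_hom_ext; rewrite /= comp1m. Qed.
Next Obligation. by move=> *; apply: seq_hom_ext; rewrite /= compm1. Qed.

Program Definition Seq_fin (T : topcat) : category :=
  @Category (subshift T) fin_hom fin_id fin_comp _ _ _.
Next Obligation.
by move=> *; apply: fin_hom_ext; rewrite /= ?compA ?addnA.
Qed.
Next Obligation.
by move=> *; apply: fin_hom_ext; rewrite /= ?comp1m ?addn0.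
Qed.
Next Obligation. by move=> *; apply: fin_hom_ext; rewrite /= ?compm1. Qed.

(* tsd_s n and tsd_f n are the morphisms s_(n+1), f_(n+1) : X_(n+1) -> X_n. *)
Record tsd (T : topcat) := Tsd {
  tsd_alphabet : T;
  tsd_ob :> nat -> T;
  tsd_inc : forall n, hom (tsd_ob n) (power tsd_alphabet 'I_n.+1);
  tsd_inc_mono : forall n, mono (tsd_inc n);
  tsd_s : forall n, hom (tsd_ob n.+1) (tsd_ob n);
  tsd_f : forall n, hom (tsd_ob n.+1) (tsd_ob n);
  tsd_sE : forall n,
    tsd_inc n \c tsd_s n = del_first tsd_alphabet n \c tsd_inc n.+1;
  tsd_fE : forall n,
    tsd_inc n \c tsd_f n = del_last tsd_alphabet n \c tsd_inc n.+1 }.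

Arguments tsd_s {T} _ n.
Arguments tsd_f {T} _ n.
Arguments tsd_inc {T} _ n.

Section TimeSeriesData.
Context {T : topcat}.
Implicit Types X Y Z : tsd T.

Record tsd_hom X Y := TsdHom {
  jump : nat;
  tsd_mor : forall n, hom (X (n + jump)) (Y n);
  tsd_mor_s : forall n,
    tsd_mor n \c tsd_s X (n + jump) = tsd_s Y n \c tsd_mor n.+1;
  tsd_mor_f : forall n,
    tsd_mor n \c tsd_f X (n + jump) = tsd_f Y n \c tsd_mor n.+1 }.

(* The identity X_m -> X_n along a proof of m = n: for instance n + (k + l)
   and n + l + k are equal, but not convertible. *)
Definition idx X m n (e : m = n) : hom (X m) (X n) :=
  ecast p (hom (X m) (X p)) e (idm (X m)).

Lemma idx_id X n (e : n = n) : idx X e = idm (X n).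
Proof. by rewrite (eq_irrelevance e erefl). Qed.

Lemma idx_comp X m n p (e : m = n) (e' : n = p) (e'' : m = p) :
  idx X e' \c idx X e = idx X e''.
Proof. by case: _ / e' e'' => e''; rewrite idx_id comp1m (eq_irrelevance e e''). Qed.

Lemma idx_s X m n (e : m = n) (e' : m.+1 = n.+1) :
  idx X e \c tsd_s X m = tsd_s X n \c idx X e'.
Proof. by case: _ / e e' => e'; rewrite !idx_id comp1m compm1. Qed.

Lemma idx_f X m n (e : m = n) (e' : m.+1 = n.+1) :
  idx X e \c tsd_f X m = tsd_f X n \c idx X e'.
Proof. by case: _ / e e' => e'; rewrite !idx_id comp1m compm1. Qed.

Lemma idx_mor X Y (f : tsd_hom X Y) m n (e : m = n)
    (e' : m + jump f = n + jump f) :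
  idx Y e \c tsd_mor f m = tsd_mor f n \c idx X e'.
Proof. by case: _ / e e' => e'; rewrite !idx_id comp1m compm1. Qed.

Lemma tsd_hom_ext X Y (f g : tsd_hom X Y) : jump f = jump g ->
  (forall n (e : n + jump f = n + jump g),
     tsd_mor f n = tsd_mor g n \c idx X e) -> f = g.
Proof.
case: f g => [k f fs ff] [l g gs gf] /= kl.
case: _ / kl g gs gf => g gs gf fg.
have {}fg : f = g.
  by apply: functional_extensionality_dep => n; rewrite (fg n erefl) compm1.
case: _ / fg gs gf => gs gf.
by congr TsdHom; exact: Prop_irrelevance.
Qed.

Program Definition tsd_id X : tsd_hom X X :=
  @TsdHom X X 0 (fun n => idx X (addn0 n)) _ _.
Next Obligation. by move=> X n; exact: idx_s. Qed.
Next Obligation. by move=> X n; exact: idx_f. Qed.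

Definition jump_comp n k l : n + (k + l) = n + l + k :=
  etrans (congr1 (addn n) (addnC k l)) (addnA n l k).

Program Definition tsd_comp X Y Z (g : tsd_hom Y Z) (f : tsd_hom X Y) :
    tsd_hom X Z :=
  @TsdHom X Z (jump f + jump g) (fun n =>
    tsd_mor g n \c tsd_mor f (n + jump g) \c
      idx X (jump_comp n (jump f) (jump g))) _ _.
Next Obligation.
move=> X Y Z g f n.
have e : (n + (jump f + jump g)).+1 = (n + jump g + jump f).+1.
  exact: (jump_comp n.+1).
rewrite -(compA (tsd_mor g n \c _)) (idx_s X _ e) !compA.
rewrite -(compA (tsd_mor g n)) tsd_mor_s compA tsd_mor_s.
by rewrite (eq_irrelevance (jump_comp n.+1 (jump f) (jump g)) e).
Qed.
Next Obligation.
move=> X Y Z g f n.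
have e : (n + (jump f + jump g)).+1 = (n + jump g + jump f).+1.
  exact: (jump_comp n.+1).
rewrite -(compA (tsd_mor g n \c _)) (idx_f X _ e) !compA.
rewrite -(compA (tsd_mor g n)) tsd_mor_f compA tsd_mor_f.
by rewrite (eq_irrelevance (jump_comp n.+1 (jump f) (jump g)) e).
Qed.

End TimeSeriesData.

Program Definition TSD (T : topcat) : category :=
  @Category (tsd T) tsd_hom tsd_id tsd_comp _ _ _.
Next Obligation.
move=> T X Y Z W h g f; apply: tsd_hom_ext => /= [|n e]; first by rewrite addnA.
have e' : n + (jump g + jump h) + jump f = n + jump h + jump g + jump f.
  by rewrite jump_comp.
rewrite -!compA; congr comp; congr comp.
rewrite [RHS]compA (idx_mor _ e') -compA; congr comp.
have e1 : n + (jump f + jump g + jump h) = n + jump h + jump g + jump f.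
  by rewrite !jump_comp.
by rewrite !(idx_comp _ _ _ e1) (idx_comp _ _ _ (etrans e (jump_comp _ _ _))) (idx_comp _ _ _ e1).
Qed.
Next Obligation.
move=> T X Y f; apply: tsd_hom_ext => /= [|n e]; first by rewrite addn0.
have e' : n + 0 + jump f = n + jump f by rewrite addn0.
by rewrite (idx_mor _ e') -compA (idx_comp _ _ _ e).
Qed.
Next Obligation.
move=> T X Y f; apply: tsd_hom_ext => //= n e.
by rewrite -compA (idx_comp _ _ _ e).
Qed.

Section Words.
Context {T : topcat}.
Implicit Types S : subshift T.

Lemma word_incE n S :
  word_inc n S \c word_epi n S = first_coords (alphabet S) n \c incl S.
Proof. exact: im_fact. Qed.

Lemma word_s_subproof S n : exists s : hom (word n.+1 S) (word n S),
  word_inc n S \c s = del_first (alphabet S) n \c word_inc n.+1 S.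
Proof.
have [|s sE] := @im_factor T _ _ _
    (first_coords (alphabet S) n.+1 \c incl S) (word_epi n S \c shift_on S).
  move=> x y /word_epi_eq xy; rewrite !underM /=; apply/word_epi_eq => i ile.
  by rewrite !coord_shift xy.
exists s; apply: im_epi_epi; rewrite -!compA sE word_incE.
rewrite compA word_incE -compA shift_onE !compA !reindex_comp.
by congr comp; congr reindex; apply/funext => i; rewrite /= /bump.
Qed.

Lemma word_f_subproof S n : exists f : hom (word n.+1 S) (word n S),
  word_inc n S \c f = del_last (alphabet S) n \c word_inc n.+1 S.
Proof.
have [|f fE] := @im_factor T _ _ _
    (first_coords (alphabet S) n.+1 \c incl S) (word_epi n S).
  move=> x y /word_epi_eq xy; apply/word_epi_eq => i ile.
  by rewrite xy // leqW.
exists f; apply: im_epi_epi; rewrite -!compA fE !word_incE.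
rewrite !compA !reindex_comp.
congr comp; congr reindex; apply/funext => i.
by rewrite /= /bump leqNgt ltn_ord.
Qed.

Definition word_s S n : hom (word n.+1 S) (word n S) :=
  sval (cid (word_s_subproof S n)).

Definition word_f S n : hom (word n.+1 S) (word n S) :=
  sval (cid (word_f_subproof S n)).

Definition word_tsd S : tsd T :=
  @Tsd T (alphabet S) (fun n => word n S) (fun n => word_inc n S)
    (fun n => @im_inc_mono T _ _ _) (word_s S) (word_f S)
    (fun n => svalP (cid (word_s_subproof S n)))
    (fun n => svalP (cid (word_f_subproof S n))).

End Words.

(* Main.v *)
Require Import Defs.
From mathcomp Require Import all_boot.
From mathcomp Require Import boolp.

(** An [n]-morphism [f : S -> S'] is a sliding block code of window [n]: as it
    commutes with the shifts, the word of length [m + 1] at the start of [f x]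
    depends only on the word of length [m + n + 1] at the start of [x]
    ([nmorphism_word]), and this dependence is the morphism [word_map f m].

    Everything else follows from the fact that the quotients
    [word_epi m S : S -> word m S] are epimorphisms: two morphisms out of
    [word m S] agree as soon as they agree on the points of the subshift.  On
    points, [word_map f] is [f], deleting the first letter is the shift
    ([word_s_epi]), and deleting the last letter is the identity
    ([word_f_epi]).  Hence the compatibility of [word_map f] with the deletions
    of letters reduces to [f] commuting with the shift and with the identity,
    and functoriality reduces to the associativity of composition in the
    underlying category. *)

Section WordFunctor.
(* [comp] and [compA] refer again to categories, not to functions. *)
Import Defs.
Context {T : topcat}.
Implicit Types S : subshift T.

(** Along the quotients to words, deleting the first letter is the shift: both
    sides select the coordinates [1, ..., n + 1]. *)
Lemma word_s_epi S n :
  word_s S n \c word_epi n.+1 S = word_epi n S \c shift_on S.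
Proof.
apply: (@im_inc_mono T _ _ (first_coords (alphabet S) n \c incl S)).
rewrite -/(word_inc n S) !compA (svalP (cid (word_s_subproof S n))).
rewrite -compA !word_incE -compA shift_onE !compA !reindex_comp.
by congr comp; congr reindex; apply/funext => i; rewrite /= /bump.
Qed.

Lemma word_f_epi S n : word_f S n \c word_epi n.+1 S = word_epi n S.
Proof.
apply: (@im_inc_mono T _ _ (first_coords (alphabet S) n \c incl S)).
rewrite -/(word_inc n S) compA (svalP (cid (word_f_subproof S n))).
rewrite -compA !word_incE compA reindex_comp.
congr comp; congr reindex; apply/funext => i.
by rewrite /= /bump leqNgt ltn_ord.
Qed.

(** The reindexing isomorphisms in the composition of time series data do
    nothing to points of the subshift. *)
Lemma idx_word_epi S m n (e : m = n) :
  idx (word_tsd S) e \c word_epi m S = word_epi n S.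
Proof. by case: _ / e; rewrite idx_id comp1m. Qed.

Definition word_map {S S'} (f : fin_hom S S') n :
    hom (word (n + window f) S) (word n S') :=
  sval (cid (nmorphism_word (fin_morP f) n)).

Lemma word_map_epi {S S'} (f : fin_hom S S') n :
  word_map f n \c word_epi (n + window f) S = word_epi n S' \c f.
Proof. exact: svalP (cid (nmorphism_word (fin_morP f) n)). Qed.

Lemma word_map_s S S' (f : fin_hom S S') n :
  word_map f n \c word_s S (n + window f) = word_s S' n \c word_map f n.+1.
Proof.
apply: im_epi_epi; rewrite -/(word_epi (n + window f).+1 S) -!compA.
rewrite word_s_epi (word_map_epi f n.+1) !compA word_map_epi word_s_epi.
by rewrite -!compA seq_morE.
Qed.

Lemma word_map_f S S' (f : fin_hom S S') n :
  word_map f n \c word_f S (n + window f) = word_f S' n \c word_map f n.+1.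
Proof.
apply: im_epi_epi; rewrite -/(word_epi (n + window f).+1 S) -!compA.
by rewrite word_f_epi (word_map_epi f n.+1) !compA word_map_epi word_f_epi.
Qed.

Definition word_hom S S' (f : fin_hom S S') :
    tsd_hom (word_tsd S) (word_tsd S') :=
  @TsdHom T (word_tsd S) (word_tsd S') (window f) (word_map f)
    (word_map_s S S' f) (word_map_f S S' f).

Lemma word_hom_id S : word_hom S S (fin_id S) = tsd_id (word_tsd S).
Proof.
apply: tsd_hom_ext => //= n e.
apply: im_epi_epi; rewrite -/(word_epi (n + 0) S) -!compA.
by rewrite (word_map_epi (fin_id S)) !idx_word_epi compm1.
Qed.

Lemma word_hom_comp S S' S'' (g : fin_hom S' S'') (f : fin_hom S S') :
  word_hom S S'' (fin_comp g f) =
  tsd_comp (word_hom S' S'' g) (word_hom S S' f).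
Proof.
apply: tsd_hom_ext => //= n e.
apply: im_epi_epi; rewrite -/(word_epi (n + (window f + window g)) S) -!compA.
rewrite (word_map_epi (fin_comp g f)) !idx_word_epi word_map_epi.
by rewrite !compA word_map_epi.
Qed.

End WordFunctor.

Theorem theorem3 (T : topcat) :
  exists W : @functor_on (Seq_fin T) (TSD T) (fun S : subshift T => word_tsd S),
    forall (S S' : subshift T) (f : fin_hom S S'),
      let Wf : tsd_hom (word_tsd S) (word_tsd S') := fmap W f in
      jump Wf = window f /\
      forall n : nat,
        tsd_mor Wf n \c word_epi (n + jump Wf) S = word_epi n S' \c f.
Proof.
exists (@FunctorOn (Seq_fin T) (TSD T) (fun S : subshift T => word_tsd S)
  word_hom word_hom_id (fun S S' S'' => word_hom_comp S S' S'')).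
by move=> S S' f /=; split=> // n; exact: word_map_epi.
Qed.
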